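(* Let $X$ be a Hausdorff topological group with operations and let $G$ be a regular $G$-method for $X$ which preserves the $G$-convergence of subsequences. If $X$ is $G$-compact, then every $G$-closed subset of $X\times X$ is $G$-compact.
   Context: Groups with operations. A category of groups with operations consists of groups (written additively, not necessarily abelian) with a set of operations $\Omega=\Omega_0\cup\Omega_1\cup\Omega_2$ ($\Omega_i$ the $i$-ary operations) and a set of identities including the group laws, such that: $\Omega_0=\{0\}$; $-\in\Omega_1$, $+\in\Omega_2$; with $\Omega_1'=\Omega_1\setminus\{-\}$ and $\Omega_2'=\Omega_2\setminus\{+\}$, if $\star\in\Omega_2'$ then $\star^\circ$, defined by $x\star^\circ y=y\star x$, is in $\Omega_2'$; and for $\star\in\Omega_2'$, $\omega\in\Omega_1'$ the identities $x\star(y+z)=x\star y+x\star z$, $\omega(x+y)=\omega(x)+\omega(y)$, $\omega(x)\star y=\omega(x\star y)$ hold. A morphism of groups with operations is a group homomorphism preserving the operations of $\Omega_1'$ and $\Omega_2'$. A subgroup with operations is a subgroup closed under all operations in $\Omega_1$ and $\Omega_2$. A topological group with operations is such an object with a topology making all operations continuous. $G$-methods. Let $s(X)$ be the set of all sequences in $X$, a group with operations under termwise operations. A $G$-method for $X$ is a morphism of groups with operations $G\colon c_G(X)\to X$ defined on a subgroup with operations $c_G(X)$ of $s(X)$. A sequence $\mathbf{x}$ is $G$-convergent to $\ell$ if $\mathbf{x}\in c_G(X)$ and $G(\mathbf{x})=\ell$; writing $G(\mathbf{x})=\ell$ includes $\mathbf{x}\in c_G(X)$. $G$ is regular if every convergent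 sequence $\mathbf{x}$ in $X$ lies in $c_G(X)$ and $G(\mathbf{x})=\lim\mathbf{x}$. $G$ preserves the $G$-convergence of subsequences if, whenever $G(\mathbf{x})=\ell$, every subsequence of $\mathbf{x}$ is also $G$-convergent to $\ell$. Product. $X\times X$ carries the product topology and componentwise operations, and $G$ is applied to sequences in $X\times X$ componentwise: $(\mathbf{x},\mathbf{y})=((x_n,y_n))$ is $G$-convergent iff $\mathbf{x}$ and $\mathbf{y}$ are, and then $G(\mathbf{x},\mathbf{y})=(G(\mathbf{x}),G(\mathbf{y}))$. $G$-closedness and $G$-compactness. A subset $A$ of $X$ (or of $X\times X$) is $G$-closed if whenever $\mathbf{x}$ is a sequence of points of $A$ with $G(\mathbf{x})=\ell$, then $\ell\in A$. It is $G$-compact if every sequence of points in $A$ has a subsequence $\mathbf{y}$ with $G(\mathbf{y})=\ell\in A$. *)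

(* Defs.v *)
From HB Require Import structures.
From mathcomp Require Import all_boot.
From mathcomp Require Import boolp classical_sets functions topology.

Set Implicit Arguments.
Unset Strict Implicit.
Unset Printing Implicit Defensive.

Local Open Scope classical_set_scope.
Local Open Scope group_scope.

(** Groups with operations are written additively in the literature; here the
    group law [x + y], [- x], [0] is MathComp's (not necessarily abelian)
    [groupType], that is [x * y], [x^-1], [1]. *)

(** [Omega1] and [Omega2] are the operation symbols other than the group
    inverse and the group law; [rev2 s] is the symbol of the opposite operation
    of [s]. *)
Record signature := Signature {
  Omega1 : Type;
  Omega2 : Type;
  rev2 : Omega2 -> Omega2
}.

Inductive term (S : signature) :=
  | TVar of nat
  | TOne
  | TInv of term S
  | TMul of term S & term S
  | TOp1 of Omega1 S & term S
  | TOp2 of Omega2 S & term S & term S.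

(** A category of groups with operations: a signature, together with the
    identities imposed in addition to the group laws and to the axioms of
    [isGroupWithOperations] below, which every such category satisfies. *)
Record gwo_theory := GwoTheory {
  gwo_sig :> signature;
  gwo_identities : set (term gwo_sig * term gwo_sig)
}.
Arguments gwo_identities : clear implicits.

HB.mixin Record hasOperations (S : signature) X := {
  op1 : Omega1 S -> X -> X;
  op2 : Omega2 S -> X -> X -> X
}.

HB.structure Definition OpGroup (S : signature) :=
  {X of Group X & hasOperations S X}.

Arguments op1 {S s} _ _ : rename.
Arguments op2 {S s} _ _ _ : rename.

Fixpoint teval (S : signature) (X : OpGroup.type S) (v : nat -> X)
    (t : term S) : X :=
  match t with
  | TVar n => v n
  | TOne => 1
  | TInv a => (teval v a)^-1
  | TMul a b => teval v a * teval v b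
  | TOp1 w a => op1 w (teval v a)
  | TOp2 s a b => op2 s (teval v a) (teval v b)
  end.

HB.mixin Record isGroupWithOperations (T : gwo_theory) X of OpGroup T X := {
  op2_rev : forall (s : Omega2 T) (x y : X), op2 (rev2 s) x y = op2 s y x;
  op2_mulr : forall (s : Omega2 T) (x y z : X),
    op2 s x (y * z) = op2 s x y * op2 s x z;
  op1_mul : forall (w : Omega1 T) (x y : X), op1 w (x * y) = op1 w x * op1 w y;
  op2_op1 : forall (w : Omega1 T) (s : Omega2 T) (x y : X),
    op2 s (op1 w x) y = op1 w (op2 s x y);
  gwo_identityP : forall e, gwo_identities T e ->
    forall v : nat -> X, teval v e.1 = teval v e.2
}.

#[short(type="gwoType")]
HB.structure Definition GroupWithOperations (T : gwo_theory) :=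
  {X of OpGroup T X & isGroupWithOperations T X}.

HB.mixin Record isTopologicalGwo (T : gwo_theory) X
    of Topological X & GroupWithOperations T X := {
  mulg_continuous : continuous (fun p : X * X => p.1 * p.2);
  invg_continuous : continuous (fun x : X => x^-1);
  op1_continuous : forall w : Omega1 T, continuous (fun x : X => op1 w x);
  op2_continuous : forall s : Omega2 T,
    continuous (fun p : X * X => op2 s p.1 p.2)
}.

#[short(type="topGwoType")]
HB.structure Definition TopologicalGwo (T : gwo_theory) :=
  {X of Topological X & GroupWithOperations T X & isTopologicalGwo T X}.

(** Pointwise operations on functions; for [I := nat] this is the group with
    operations of all sequences. *)
Section FunctionGwo.
Context {I : Type}.

Section FunctionGroup.
Variable X : groupType.

Let mulf (f g : I -> X) : I -> X := fun i => f i * g i.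
Let onef : I -> X := fun=> 1.
Let invf (f : I -> X) : I -> X := fun i => (f i)^-1.

Let mulfA : associative mulf.
Proof. by move=> f g h; apply/funext => i; exact: mulgA. Qed.
Let mul1f : left_id onef mulf.
Proof. by move=> f; apply/funext => i; exact: mul1g. Qed.
Let mulf1 : right_id onef mulf.
Proof. by move=> f; apply/funext => i; exact: mulg1. Qed.
Let mulVf : left_inverse onef invf mulf.
Proof. by move=> f; apply/funext => i; exact: mulVg. Qed.
Let mulfV : right_inverse onef invf mulf.
Proof. by move=> f; apply/funext => i; exact: mulgV. Qed.

HB.instance Definition _ :=
  isGroup.Build (I -> X) mulfA mul1f mulf1 mulVf mulfV.

End FunctionGroup.

HB.instance Definition _ (S : signature) (X : OpGroup.type S) :=
  hasOperations.Build S (I -> X)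
    (fun w f i => op1 w (f i)) (fun s f g i => op2 s (f i) (g i)).

Lemma teval_fct (S : signature) (X : OpGroup.type S) (v : nat -> I -> X)
    (t : term S) (i : I) : teval v t i = teval (fun n => v n i) t.
Proof.
by elim: t => //= [a <-|a <- b <-|w a <-|s a <- b <-].
Qed.

Section FunctionLaws.
Variables (T : gwo_theory) (X : gwoType T).

Let fop2_rev (s : Omega2 T) (x y : I -> X) : op2 (rev2 s) x y = op2 s y x.
Proof. by apply/funext => i; exact: op2_rev. Qed.
Let fop2_mulr (s : Omega2 T) (x y z : I -> X) :
  op2 s x (y * z) = op2 s x y * op2 s x z.
Proof. by apply/funext => i; exact: op2_mulr. Qed.
Let fop1_mul (w : Omega1 T) (x y : I -> X) :
  op1 w (x * y) = op1 w x * op1 w y.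
Proof. by apply/funext => i; exact: op1_mul. Qed.
Let fop2_op1 (w : Omega1 T) (s : Omega2 T) (x y : I -> X) :
  op2 s (op1 w x) y = op1 w (op2 s x y).
Proof. by apply/funext => i; exact: op2_op1. Qed.
Let fidentityP e : gwo_identities T e ->
  forall v : nat -> I -> X, teval v e.1 = teval v e.2.
Proof.
by move=> Te v; apply/funext => i; rewrite !teval_fct; exact: gwo_identityP.
Qed.

HB.instance Definition _ := isGroupWithOperations.Build T (I -> X)
  fop2_rev fop2_mulr fop1_mul fop2_op1 fidentityP.

End FunctionLaws.
End FunctionGwo.

Section ProductGwo.

HB.instance Definition _ (S : signature) (X Y : OpGroup.type S) :=
  hasOperations.Build S (X * Y)%type
    (fun w p => (op1 w p.1, op1 w p.2))
    (fun s p q => (op2 s p.1 q.1, op2 s p.2 q.2)).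

Lemma teval_pair (S : signature) (X Y : OpGroup.type S) (v : nat -> X * Y)
    (t : term S) :
  teval v t = (teval (fun n => (v n).1) t, teval (fun n => (v n).2) t).
Proof.
by elim: t => //= [n|a ->|a -> b ->|w a ->|s a -> b ->] //; case: (v n).
Qed.

Variables (T : gwo_theory) (X Y : gwoType T).

Let pop2_rev (s : Omega2 T) (x y : X * Y) : op2 (rev2 s) x y = op2 s y x.
Proof. by congr pair; exact: op2_rev. Qed.
Let pop2_mulr (s : Omega2 T) (x y z : X * Y) :
  op2 s x (y * z) = op2 s x y * op2 s x z.
Proof. by congr pair; exact: op2_mulr. Qed.
Let pop1_mul (w : Omega1 T) (x y : X * Y) :
  op1 w (x * y) = op1 w x * op1 w y.
Proof. by congr pair; exact: op1_mul. Qed.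
Let pop2_op1 (w : Omega1 T) (s : Omega2 T) (x y : X * Y) :
  op2 s (op1 w x) y = op1 w (op2 s x y).
Proof. by congr pair; exact: op2_op1. Qed.
Let pidentityP e : gwo_identities T e ->
  forall v : nat -> X * Y, teval v e.1 = teval v e.2.
Proof. by move=> Te v; rewrite !teval_pair; congr pair; exact: gwo_identityP. Qed.

HB.instance Definition _ := isGroupWithOperations.Build T (X * Y)%type
  pop2_rev pop2_mulr pop1_mul pop2_op1 pidentityP.

End ProductGwo.

Section ProductTopGwo.
Variables (T : gwo_theory) (X Y : topGwoType T).

Let pair_continuous (P A B : topologicalType) (f : P -> A) (g : P -> B) :
  continuous f -> continuous g -> continuous (fun p => (f p, g p)).
Proof. by move=> cf cg p; apply: cvg_pair; [exact: cf|exact: cg]. Qed.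

Let comp_continuous (P A B : topologicalType) (f : P -> A) (g : A -> B) :
  continuous g -> continuous f -> continuous (g \o f).
Proof. by move=> cg cf p; apply: continuous_comp; [exact: cf|exact: cg]. Qed.

Let fst_continuous (A B : topologicalType) : continuous (@fst A B).
Proof. by move=> p; exact: cvg_fst. Qed.

Let snd_continuous (A B : topologicalType) : continuous (@snd A B).
Proof. by move=> p; exact: cvg_snd. Qed.

Let prod2_continuous (f : X -> X -> X) (g : Y -> Y -> Y) :
  continuous (fun p : X * X => f p.1 p.2) ->
  continuous (fun p : Y * Y => g p.1 p.2) ->
  continuous (fun p : (X * Y) * (X * Y) =>
    (f p.1.1 p.2.1, g p.1.2 p.2.2)).
Proof.
have f1 A B := @fst_continuous A B; have s1 A B := @snd_continuous A B.
move=> cf cg; apply: pair_continuous.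
  apply: (comp_continuous (f := fun p => (p.1.1, p.2.1)) cf).
  by apply: pair_continuous;
    [exact: (comp_continuous (f1 _ _) (f1 _ _))
    |exact: (comp_continuous (f1 _ _) (s1 _ _))].
apply: (comp_continuous (f := fun p => (p.1.2, p.2.2)) cg).
by apply: pair_continuous;
  [exact: (comp_continuous (s1 _ _) (f1 _ _))
  |exact: (comp_continuous (s1 _ _) (s1 _ _))].
Qed.

Let prod1_continuous (f : X -> X) (g : Y -> Y) :
  continuous f -> continuous g ->
  continuous (fun p : X * Y => (f p.1, g p.2)).
Proof.
move=> cf cg; apply: pair_continuous.
  exact: (comp_continuous cf (@fst_continuous _ _)).
exact: (comp_continuous cg (@snd_continuous _ _)).
Qed.

Let pmulg_continuous : continuous (fun p : (X * Y) * (X * Y) => p.1 * p.2).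
Proof. exact: (prod2_continuous mulg_continuous mulg_continuous). Qed.
Let pinvg_continuous : continuous (fun p : X * Y => p^-1).
Proof. exact: (prod1_continuous invg_continuous invg_continuous). Qed.
Let pop1_continuous (w : Omega1 T) : continuous (fun p : X * Y => op1 w p).
Proof. exact: (prod1_continuous (op1_continuous w) (op1_continuous w)). Qed.
Let pop2_continuous (s : Omega2 T) :
  continuous (fun p : (X * Y) * (X * Y) => op2 s p.1 p.2).
Proof. exact: (prod2_continuous (op2_continuous s) (op2_continuous s)). Qed.

HB.instance Definition _ := isTopologicalGwo.Build T (X * Y)%type
  pmulg_continuous pinvg_continuous pop1_continuous pop2_continuous.

End ProductTopGwo.

Record sub_gwo (T : gwo_theory) (X : gwoType T) (D : set X) : Prop := SubGwo {
  sub_gwo1 : D 1;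
  sub_gwoM : forall x y, D x -> D y -> D (x * y);
  sub_gwoV : forall x, D x -> D x^-1;
  sub_gwo_op1 : forall (w : Omega1 T) x, D x -> D (op1 w x);
  sub_gwo_op2 : forall (s : Omega2 T) x y, D x -> D y -> D (op2 s x y)
}.

Record gwo_morphism_on (T : gwo_theory) (X Y : gwoType T) (D : set X)
    (f : X -> Y) : Prop := GwoMorphismOn {
  gwo_morphM : forall x y, D x -> D y -> f (x * y) = f x * f y;
  gwo_morph_op1 : forall (w : Omega1 T) x, D x -> f (op1 w x) = op1 w (f x);
  gwo_morph_op2 : forall (s : Omega2 T) x y, D x -> D y ->
    f (op2 s x y) = op2 s (f x) (f y)
}.

(** [gdom G] is the domain [c_G(X)]; the values of [gfun G] outside of it are
    irrelevant. *)
Record gmethod (T : gwo_theory) (X : gwoType T) := GMethod {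
  gdom : set (nat -> X);
  gfun : (nat -> X) -> X;
  gdom_sub : sub_gwo gdom;
  gfun_morph : gwo_morphism_on gdom gfun
}.

(** [G(x) = l], including [x \in c_G(X)]. *)
Definition glim (T : gwo_theory) (X : gwoType T) (G : gmethod X)
    (x : nat -> X) (l : X) : Prop :=
  gdom G x /\ gfun G x = l.

Definition subsequence (X : Type) (y x : nat -> X) : Prop :=
  exists2 k : nat -> nat, {homo k : m n / (m < n)%N} & y = x \o k.

Definition gregular (T : gwo_theory) (X : topGwoType T) (G : gmethod X) : Prop :=
  forall (x : nat -> X) (l : X), x @ \oo --> l -> glim G x l.

Definition gpreserves_subsequences (T : gwo_theory) (X : gwoType T)
    (G : gmethod X) : Prop :=
  forall (x y : nat -> X) (l : X), glim G x l -> subsequence y x -> glim G y l.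

Definition gclosed (T : gwo_theory) (X : gwoType T) (G : gmethod X)
    (A : set X) : Prop :=
  forall (x : nat -> X) (l : X), (forall n, A (x n)) -> glim G x l -> A l.

Definition gcompact (T : gwo_theory) (X : gwoType T) (G : gmethod X)
    (A : set X) : Prop :=
  forall x : nat -> X, (forall n, A (x n)) ->
    exists2 y, subsequence y x & exists2 l, A l & glim G y l.

Section ProductMethod.
Variables (T : gwo_theory) (X Y : gwoType T) (G : gmethod X) (H : gmethod Y).

Let pdom : set (nat -> X * Y) :=
  [set z | gdom G (fst \o z) /\ gdom H (snd \o z)].

Let pfun (z : nat -> X * Y) : X * Y := (gfun G (fst \o z), gfun H (snd \o z)).

Let pdom_sub : sub_gwo pdom.
Proof.
have [G1 GM GV Go1 Go2] := gdom_sub G; have [H1 HM HV Ho1 Ho2] := gdom_sub H.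
split=> [|x y [] ? ? [] ? ?|x [] ? ?|w x [] ? ?|s x y [] ? ? [] ? ?].
- by split.
- by split; [exact: (GM (fst \o x) (fst \o y))|exact: (HM (snd \o x) (snd \o y))].
- by split; [exact: (GV (fst \o x))|exact: (HV (snd \o x))].
- by split; [exact: (Go1 w (fst \o x))|exact: (Ho1 w (snd \o x))].
- by split; [exact: (Go2 s (fst \o x) (fst \o y))
            |exact: (Ho2 s (snd \o x) (snd \o y))].
Qed.

Let pfun_morph : gwo_morphism_on pdom pfun.
Proof.
have [GM Go1 Go2] := gfun_morph G; have [HM Ho1 Ho2] := gfun_morph H.
split=> [x y [] ? ? [] ? ?|w x [] ? ?|s x y [] ? ? [] ? ?].
- by congr pair; [exact: (GM (fst \o x) (fst \o y))
                 |exact: (HM (snd \o x) (snd \o y))].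
- by congr pair; [exact: (Go1 w (fst \o x))|exact: (Ho1 w (snd \o x))].
- by congr pair; [exact: (Go2 s (fst \o x) (fst \o y))
                 |exact: (Ho2 s (snd \o x) (snd \o y))].
Qed.

Definition gmethod_prod : gmethod (X * Y)%type := GMethod pdom_sub pfun_morph.

Lemma glim_prod (z : nat -> X * Y) (p : X * Y) :
  glim gmethod_prod z p <-> glim G (fst \o z) p.1 /\ glim H (snd \o z) p.2.
Proof.
case: p => a b; split=> [[[Gz Hz] [<- <-]]|[/= [Gz Ga] [Hz Hb]]]; first by [].
by split; [split|rewrite /= /pfun Ga Hb].
Qed.

End ProductMethod.

(* Main.v *)
Require Import Defs.
From HB Require Import structures.
From mathcomp Require Import all_boot.
From mathcomp Require Import boolp classical_sets functions topology.

(** The proof is the sequential one for ordinary compactness. A product of two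
    [G]-compact sets is [G]-compact: extract a subsequence along which the first
    components have a [G]-limit, then a further one along which the second
    components do; the first components keep their limit because [G] preserves
    the [G]-convergence of subsequences ([gcompact_setX]). Hence
    [X * X] is [G]-compact, and a [G]-closed subset of a [G]-compact set is
    [G]-compact because it contains the [G]-limits of the subsequences extracted
    from its own sequences ([gclosed_gcompact]). *)

Local Open Scope classical_set_scope.

Lemma gclosed_gcompact (T : gwo_theory) (X : gwoType T) (G : gmethod X)
    (A K : set X) :
  gclosed G A -> A `<=` K -> gcompact G K -> gcompact G A.
Proof.
move=> clA AK cK x Ax.
have [y [k k_incr ->] [l _ Gl]] := cK x (fun n => AK _ (Ax n)).
exists (x \o k); first by exists k.
by exists l => //; apply: clA Gl => n; exact: Ax.
Qed.

(** Along the second extraction the first components are a subsequence of an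
    already [G]-convergent sequence; this is where [G] has to preserve the
    [G]-convergence of subsequences. *)
Lemma gcompact_setX (T : gwo_theory) (X Y : gwoType T)
    (G : gmethod X) (H : gmethod Y) (A : set X) (B : set Y) :
  gpreserves_subsequences G -> gcompact G A -> gcompact H B ->
  gcompact (gmethod_prod G H) (A `*` B).
Proof.
move=> Gsub cA cB z ABz.
have [_ [k k_incr ->] [a Aa Ga]] := cA (fst \o z) (fun n => (ABz n).1).
have [_ [j j_incr ->] [b Bb Hb]] :=
  cB (snd \o z \o k) (fun n => (ABz (k n)).2).
exists (z \o (k \o j)).
  by exists (k \o j) => // m n /j_incr /k_incr.
exists (a, b); first by split.
apply/glim_prod; split; last exact: Hb.
by apply: Gsub Ga _; exists j.
Qed.

Theorem theorem3p2 (T : gwo_theory) (X : topGwoType T) (G : gmethod X)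
    (X_hausdorff : hausdorff_space X)
    (G_regular : gregular G)
    (G_subsequences : gpreserves_subsequences G)
    (X_gcompact : gcompact G [set: X]) :
  forall A : set (X * X),
    gclosed (gmethod_prod G G) A -> gcompact (gmethod_prod G G) A.
Proof.
move=> A clA; apply: (gclosed_gcompact _ _ _ _ ([set: X] `*` [set: X])) => //.
exact: gcompact_setX.
Qed.
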